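(* Let $0<T\le+\infty$, $a,b\ge 0$, $\alpha>\delta\ge 0$, $0<\beta<1$, $p>\frac1\beta$ and $q=\frac{p}{p-1}$. Let $f:(0,T)\times\mathbb{R}\to\mathbb{R}$ be a continuous function with $$|f(t,x)|\le l(t)\,\omega(t^{\alpha}|x|)\quad\text{for all }(t,x)\in(0,T)\times\mathbb{R},$$ where $l\in C(0,T)\cap L^{p}_{Loc}[0,T)$ is a nonnegative function and $\omega\in C[0,+\infty)$ is a nondecreasing, nonnegative function. Let $u$ be such that $t^{\alpha}u(t)$ is a continuous, nonnegative function on $[0,T)$ and $$u(t)\le a\,t^{-\alpha}+b\,t^{-\delta}\int_{0}^{t}(t-s)^{\beta-1}f(s,u(s))\,ds,\qquad t\in(0,T).$$ Then $$u(t)\le 2^{1-\frac1p}\,t^{-\alpha}\left(\Omega^{-1}\left(\Omega(a^{p})+c^{p}(t)\int_{0}^{t}l^{p}(s)\,ds\right)\right)^{\frac1p},\qquad t\in(0,T_{1}],$$ where $c(t)=\dfrac{b\,t^{\alpha-\delta+\beta-1+\frac1q}}{(q(\beta-1)+1)^{\frac1q}}$, $\mu(t)=\omega^{p}\big(2^{1-\frac1p}t^{\frac1p}\big)$, $\Omega(x)=\int_{1}^{x}\frac{1}{\mu(t)}\,dt$, $\Omega^{-1}$ is the inverse of $\Omega$, and $T_{1}\in(0,T)$ is such that $\Omega(a^{p})+c^{p}(t)\int_{0}^{t}l^{p}(s)\,ds\in\mathrm{Dom}(\Omega^{-1})$ for all $t\in[0,T_{1}]$.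
   Context: $L^{p}_{Loc}[0,T)$ denotes the functions belonging to $L^p[0,T']$ for every $0<T'<T$. $\mathrm{Dom}(\Omega^{-1})$ is the domain of the inverse function $\Omega^{-1}$, i.e. the range of $\Omega$. For a function $g$, $g^p(t)$ means $(g(t))^p$. ''$t^{\alpha}u(t)$ is continuous on $[0,T)$'' means that $u$ is defined on $(0,T)$ and $t\mapsto t^{\alpha}u(t)$ extends continuously to $t=0$. *)

(* Defs.v *)
From mathcomp Require Import all_boot all_order all_algebra.
From mathcomp Require Import all_classical all_reals all_analysis.
Import Order.TTheory GRing.Theory Num.Theory.
Import numFieldNormedType.Exports.

Set Implicit Arguments.
Unset Strict Implicit.
Unset Printing Implicit Defensive.

Local Open Scope classical_set_scope.
Local Open Scope ring_scope.

(* The half-lines are cut at T : \bar R, so that T = +oo is allowed. *)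
Definition oo_itv {R : realType} (T : \bar R) : set R :=
  [set t | 0 < t /\ (t%:E < T)%E].

Definition co_itv {R : realType} (T : \bar R) : set R :=
  [set t | 0 <= t /\ (t%:E < T)%E].

(* L^p_Loc[0,T).  The point 0 is negligible and is left out because the
   functions considered are only meaningful on (0,T). *)
Definition Lp_loc {R : realType} (p : R) (T : \bar R) (l : R -> R) : Prop :=
  forall T' : R, oo_itv T T' ->
    l \_ `]0, T'] \in Lfun (@lebesgue_measure R) p%:E.

(* "g is a continuous, nonnegative function on [0,T)" for a g which is only
   meaningful on (0,T): g extends to such a function. *)
Definition continuous_nonneg_ext {R : realType} (T : \bar R) (g : R -> R) :
    Prop :=
  exists w : R -> R,
    [/\ {within co_itv T, continuous w},
        (forall t, co_itv T t -> 0 <= w t)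
      & (forall t, oo_itv T t -> w t = g t)].

Definition mu_fun {R : realType} (omega : R -> R) (p t : R) : R :=
  omega (2 `^ (1 - p^-1) * t `^ p^-1) `^ p.

(* Omega(x) is the signed integral of 1/mu from 1 to x.  It is extended-real
   valued, with 1/0 = +oo (this is the inverse of \bar R), because a^p may be
   0 while the integral of 1/mu diverges at 0; then Omega 0 = -oo. *)
Definition Omega {R : realType} (omega : R -> R) (p x : R) : \bar R :=
  (if (1 <= x)%R
   then \int[lebesgue_measure]_(t in `[1%R, x]) ((mu_fun omega p t)%:E)^-1
   else - \int[lebesgue_measure]_(t in `[x, 1%R]) ((mu_fun omega p t)%:E)^-1)%E.

Definition Omega_inv {R : realType} (omega : R -> R) (p : R) (z : \bar R) : R :=
  xget 0 [set x | 0 <= x /\ Omega omega p x = z].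

(* The values of Omega on [0,+oo) at which the inverse of Omega makes sense.
   If omega > 0 on (0,+oo) then Omega is injective on [0,+oo) and this is the
   whole range of Omega, by Omega_inv_domE.  If omega vanishes on some [0,x0]
   with x0 > 0, then Omega may be constantly -oo (or +oo) on an interval,
   and an infinite value taken several times is not in the domain. *)
Definition Omega_inv_dom {R : realType} (omega : R -> R) (p : R) :
    set (\bar R) :=
  [set z | exists! x : R, 0 <= x /\ Omega omega p x = z].

Lemma Omega_inv_domE {R : realType} (omega : R -> R) (p : R) :
  {in `[0, +oo[%classic &, injective (Omega omega p)} ->
  Omega_inv_dom omega p = Omega omega p @` `[0, +oo[.
Proof.
have E (x : R) : (x \in `[0, +oo[%classic) = (0 <= x).
  by rewrite mem_setE in_itv/= andbT.
move=> inj; apply/seteqP; split => z /=.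
  by move=> [x [[x0 <-] _]]; exists x => //=; rewrite in_itv/= andbT.
move=> [x]; rewrite /= in_itv/= andbT => x0 <-; exists x; split=> // y [y0 yx].
by apply: inj; rewrite ?E.
Qed.

(* On its domain, Omega_inv is the inverse of Omega. *)
Lemma Omega_invP {R : realType} (omega : R -> R) (p x : R) :
  0 <= x -> Omega_inv_dom omega p (Omega omega p x) ->
  Omega_inv omega p (Omega omega p x) = x.
Proof.
move=> x0 [y [_ uniq_y]]; rewrite /Omega_inv; case: xgetP => [_ -> /= invx|].
  by rewrite -(uniq_y _ invx); exact: uniq_y.
by move/(_ x) => /=; case.
Qed.

Definition c_fun {R : realType} (b alpha beta delta q t : R) : R :=
  b * t `^ (alpha - delta + beta - 1 + q^-1) / (q * (beta - 1) + 1) `^ q^-1.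

(* The argument of Omega^{-1} in the bound at time t. *)
Definition Omega_arg {R : realType} (omega l : R -> R)
    (a b alpha beta delta p q t : R) : \bar R :=
  (Omega omega p (a `^ p) +
   (c_fun b alpha beta delta q t `^ p *
    \int[lebesgue_measure]_(s in `]0%R, t[) (l s `^ p))%:E)%E.

(* Main.v *)
(* With [w t = t^alpha u(t)], Hoelder's inequality with exponents q and p turns
   the hypothesis into [w <= a + c(t) (int_0^t l^p omega(w)^p)^(1/p)], and
   convexity of the p-th power gives, for [z = w^p / 2^(p-1)] and r <= t,
   [z r <= Z r := a^p + c(t)^p int_0^r l^p mu(z)] with t frozen in [c(t)].
   So [Z' <= c(t)^p l^p mu(Z)], and Bihari's argument yields
   [int_(a^p)^(Z t) 1/mu <= c(t)^p int_0^t l^p].  This holds with 1/0 = +oo and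
   for an integral of 1/mu diverging at a^p, because mu > 0 on all values of Z
   above a^p: Z cannot leave a^p through a region where mu vanishes.  Hence
   [Omega (Z t)] is at most the argument of [Omega^-1], and since that argument
   is a value of Omega taken only once, monotonicity of Omega concludes. *)
Require Import Defs.
From mathcomp Require Import all_boot all_order all_algebra.
From mathcomp Require Import all_classical all_reals all_analysis.
From mathcomp Require Import measurable_realfun.
From mathcomp Require Import ring lra.
Import Order.TTheory GRing.Theory Num.Theory.
Import numFieldNormedType.Exports.
Local Open Scope classical_set_scope.
Local Open Scope ring_scope.

(** * Integral and convexity inequalities *)

(** Monotone convergence along the intervals [[a + 1/(n+1), b - 1/(n+1)]], which exhaust []a, b[].
    It allows the fundamental theorem of calculus to be applied away from endpoints where the
    integrand may blow up. *)
Lemma ge0_integral_oo_le {R : realType} (f : R -> \bar R) (a b : R)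
    (K : \bar R) :
  measurable_fun `]a, b[ f -> (forall x, x \in `]a, b[ -> (0 <= f x)%E) ->
  (0 <= K)%E ->
  (forall c d, a < c -> c < d -> d < b ->
    (\int[lebesgue_measure]_(x in `[c, d]) f x <= K)%E) ->
  (\int[lebesgue_measure]_(x in `]a, b[) f x <= K)%E.
Proof.
move=> mf f0 K0 fK.
pose e (n : nat) : R := n.+1%:R^-1.
have e_gt0 n : 0 < e n by rewrite invr_gt0.
pose F n : set R := `[a + e n, b - e n]%classic.
have Fab n : F n `<=` `]a, b[.
  move=> x; rewrite /F /= !in_itv/= => /andP[ax xb]; apply/andP; split.
  - by rewrite (lt_le_trans _ ax)// ltrDl.
  - by rewrite (le_lt_trans xb)// gtrBl.
have -> : `]a, b[%classic = \bigcup_n F n.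
  apply/seteqP; split=> [x|]; last by apply: bigcup_sub => n _; exact: Fab.
  rewrite /= in_itv/= => /andP[ax xb].
  pose d := Num.min (x - a) (b - x).
  have d0 : 0 < d by rewrite lt_min !subr_gt0 ax.
  have ed : e (Num.truncn d^-1) <= d.
    by rewrite -[leRHS]invrK lef_pV2 ?posrE ?ltr0n ?invr_gt0// ltW// truncnS_gt.
  exists (Num.truncn d^-1) => //; rewrite /F/= in_itv/=.
  move: ed; rewrite le_min => /andP[? ?]; apply/andP; split; lra.
have cvF : (\int[lebesgue_measure]_(x in F i) f x)%E @[i --> \oo] -->
    (\int[lebesgue_measure]_(x in \bigcup_i F i) f x)%E.
  apply: ge0_nondecreasing_set_cvg_integral => //.
  - move=> n m nm; apply/subsetPset => x.
    rewrite /F /= !in_itv/= => /andP[ax xb].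
    have : e m <= e n by rewrite lef_pV2 ?posrE// ler_nat.
    move=> ?; apply/andP; split; lra.
  - by move=> n; exact: measurable_itv.
  - by move=> n; apply: measurable_funS mf => //; exact: Fab.
  - by move=> n x /Fab/f0.
rewrite -(cvg_lim _ cvF)//; apply: lime_le.
  by apply/cvg_ex; eexists; exact: cvF.
(* For small [n] the interval may be a point or empty; its integral is then 0, and [0 <= K] is what
   is used. *)
apply: nearW => n; have [cd|] := ltP (a + e n) (b - e n).
  by apply: fK => //; rewrite ?ltrDl ?gtrBl.
rewrite le_eqVlt => /predU1P[E|dc].
  by rewrite /F E set_itv1 integral_set1.
by rewrite /F set_itv_ge ?integral_set0// bnd_simp -ltNge.
Qed.

Lemma ge0_hoelder {R : realType} (D : set R) (f g : R -> R) (p q : R) :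
  measurable D -> measurable_fun D f -> measurable_fun D g ->
  (forall x, D x -> 0 <= f x) -> (forall x, D x -> 0 <= g x) ->
  0 < p -> 0 < q -> p^-1 + q^-1 = 1 ->
  (\int[lebesgue_measure]_(x in D) (f x * g x)%:E <=
   (\int[lebesgue_measure]_(x in D) (f x `^ p)%:E) `^ p^-1 *
   (\int[lebesgue_measure]_(x in D) (g x `^ q)%:E) `^ q^-1)%E.
Proof.
move=> mD mf mg f0 g0 p0 q0 pq.
have NE r (h : R -> R) : 0 < r -> (forall x, D x -> 0 <= h x) ->
    ('N[lebesgue_measure]_(r%:E)[EFin \o (h \_ D)] =
    (\int[lebesgue_measure]_(x in D) (h x `^ r)%:E) `^ r^-1)%E.
  move=> r0 h0; rewrite unlock/=; congr poweR.
  rewrite [RHS]integral_mkcond; apply: eq_integral => x _.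
  rewrite !patchE; case: ifPn => [|_] /=.
  - by rewrite inE => /h0 hx; rewrite ger0_norm.
  - by rewrite normr0 powR0// gt_eqF.
have := @hoelder _ _ R lebesgue_measure (f \_ D) (g \_ D) p q
  ((measurable_restrictT _ mD).1 mf) ((measurable_restrictT _ mD).1 mg) p0 q0 pq.
rewrite !NE//; apply: le_trans.
rewrite Lnorm1 [leLHS]integral_mkcond; apply: ge0_le_integral => //.
- by move=> x _; rewrite patchE; case: ifPn => // /[1!inE] Dx;
    rewrite lee_fin mulr_ge0// ?f0 ?g0.
- apply/(measurable_restrictT _ mD)/measurable_EFinP; exact: measurable_funM.
- apply: measurableT_comp => //; apply/measurable_EFinP.
  by apply: measurable_funM; exact/(measurable_restrictT _ mD).
- move=> x _; rewrite /= !patchE; case: ifPn => // _; rewrite lee_fin.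
  - exact: ler_norm.
  - exact: normr_ge0.
Qed.

(** Convexity of the p-th power at the midpoint of [x] and [y], multiplied by [2 ^ p]. *)
Lemma powRD_le {R : realType} (p x y : R) : 1 <= p -> 0 <= x -> 0 <= y ->
  (x + y) `^ p <= 2 `^ (p - 1) * (x `^ p + y `^ p).
Proof.
move=> p1 x0 y0.
have h : 0 <= (2^-1 : R) <= 1 by apply/andP; split; lra.
have := @convex_powR R p p1 (Itv01 (andP h).1 (andP h).2) x y.
rewrite !inE/= !in_itv/= !andbT => /(_ x0 y0).
rewrite convRE [X in X `^ p <= _ -> _]convRE /=; rewrite /unstable.onem/=.
have -> : 2^-1 * x + (1 - 2^-1) * y = 2^-1 * (x + y) :> R by field.
have -> : 2^-1 * x `^ p + (1 - 2^-1) * y `^ p = 2^-1 * (x `^ p + y `^ p) :> R.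
  by field.
rewrite powRM ?addr_ge0 ?invr_ge0// => H.
have E : 2 `^ (p - 1) = 2 `^ p * 2^-1 :> R.
  by rewrite powRB ?powRr1// pnatr_eq0 implybT.
rewrite E -mulrA -ler_pdivrMl ?powR_gt0//; apply: le_trans H.
by rewrite -powR_inv1// -powRrM mulN1r powRN.
Qed.

(** Precomposing [m] with [max 0 x] makes it nondecreasing on the whole line, hence measurable. The
    extended inverse is then a measurable case distinction on the zero set of [m], where it is
    [+oo]. *)
Lemma measurable_mono_inve {R : realType} (m : R -> R) (D : set R) :
  measurable D -> D `<=` `[0, +oo[ ->
  (forall x, 0 <= x -> 0 <= m x) ->
  {in `[0, +oo[ &, {homo m : x y / x <= y}} ->
  measurable_fun D (fun x => ((m x)%:E)^-1%E).
Proof.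
move=> mD D0 m0 hm.
pose m' x := m (Num.max 0 x).
have mm' : measurable_fun setT m'.
  apply: nondecreasing_measurable => // x y xy; apply: hm.
  - by rewrite in_itv/= andbT le_max lexx.
  - by rewrite in_itv/= andbT le_max lexx.
  - by rewrite ge_max !le_max lexx xy orbT.
have mm : measurable_fun setT
    (fun x => if m' x == 0 then +oo%E else (m' x `^ (-1))%:E).
  apply: measurable_fun_ifT => //; first exact: measurable_fun_eqr.
  by apply/measurable_EFinP; apply: (measurableT_comp (measurable_powR _)).
apply: eq_measurable_fun (measurable_funTS mm) => x /set_mem/D0.
rewrite /= in_itv/= andbT => x0; rewrite /m' max_r// inver powR_inv1//.
exact: m0.
Qed.

Lemma integrable_itv_oo_cc {R : realType} (f : R -> R) (a b : R) :
  lebesgue_measure.-integrable `]a, b[ (EFin \o f) ->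
  lebesgue_measure.-integrable `[a, b] (EFin \o f).
Proof.
move=> /integrableP[mf fy]; apply/integrableP; split.
  exact: emeasurable_fun_itv_cc mf.
by rewrite integral_itv_bndoo//; exact: measurableT_comp.
Qed.

Lemma Rintegral_itv_cc_oo {R : realType} (f : R -> R) (a b : R) :
  measurable_fun (`]a, b[ : set R) f ->
  \int[lebesgue_measure]_(x in `[a, b]) f x =
  \int[lebesgue_measure]_(x in `]a, b[) f x.
Proof.
by move=> mf; rewrite /Rintegral integral_itv_bndoo//; exact/measurable_EFinP.
Qed.

(** For negative [g] the integrand is singular at [s = t], so the primitive [F] is used on compact
    subintervals only, and the bound passes to the limit by exhaustion. *)
Lemma integral_powR_onem_le {R : realType} (t g : R) : 0 < t -> 0 < g + 1 ->
  (\int[lebesgue_measure]_(s in `]0%R, t[) ((t - s) `^ g)%:E <=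
   (t `^ (g + 1) / (g + 1))%:E)%E.
Proof.
move=> t0 g1.
pose F s : R := - ((t - s) `^ (g + 1) / (g + 1)).
have dpow (a s : R) : s < t ->
    is_derive s 1 (fun x => (t - x) `^ a) (- (a * (t - s) `^ (a - 1))).
  move=> st; have ts : 0 < t - s by rewrite subr_gt0.
  have dB : is_derive s 1 (fun x : R => t - x) (-1).
    by apply: is_derive_eq; rewrite add0r mul1r.
  have := @is_derive1_comp _ (@powR R ^~ a) (fun x => t - x) s _ _
    (is_derive1_powR _ ts) dB.
  by rewrite mulrN1.
have dF s : s < t -> is_derive s 1 F ((t - s) `^ g).
  move=> st; have d := dpow (g + 1) s st.
  apply: is_derive_eq; rewrite addrK scaler0 add0r scalerN opprK.
  by rewrite /GRing.scale/= mulKf// gt_eqF.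
have mk : measurable_fun setT (fun s : R => (t - s) `^ g).
  apply: (measurableT_comp (measurable_powR _)).
  exact: measurable_funB.
apply: ge0_integral_oo_le.
- by apply/measurable_EFinP; exact: measurable_funTS.
- by move=> s _; rewrite lee_fin powR_ge0.
- by rewrite lee_fin divr_ge0 ?powR_ge0// ltW.
move=> c d c0 cd dt.
have lt x : x \in `[c, d] -> x < t.
  by rewrite in_itv/= => /andP[_ xd]; rewrite (le_lt_trans xd).
rewrite (@continuous_FTC2 _ _ F)//.
- rewrite -EFinB lee_fin /F opprK addrC lerBlDr.
  rewrite (@le_trans _ _ (t `^ (g + 1) / (g + 1)))//; last first.
    by rewrite lerDl divr_ge0 ?powR_ge0// ltW.
  rewrite ler_pM2r ?invr_gt0// ge0_ler_powR ?nnegrE ?subr_ge0//.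
  + exact: ltW.
  + by rewrite ltW// (lt_trans cd).
  + exact: ltW.
  + by rewrite gerBl ltW.
- apply: derivable_within_continuous => x /lt xt.
  by have d1 := dpow g x xt; exact: ex_derive.
- split.
  + move=> x xcd; have d1 := dF x (lt x (subset_itv_oo_cc xcd)).
    exact: ex_derive.
  + apply: cvg_at_right_filter; apply: differentiable_continuous.
    apply/derivable1_diffP; have d1 := dF c (lt_trans cd dt); exact: ex_derive.
  + apply: cvg_at_left_filter; apply: differentiable_continuous.
    apply/derivable1_diffP; have d1 := dF d dt; exact: ex_derive.
- move=> x xcd; have d1 := dF x (lt x (subset_itv_oo_cc xcd)).
  by rewrite derive1E derive_val.
Qed.

(** * Continuity of compositions with powers and absolute values *)

(** Composing with the absolute value turns continuity relative to the half-line into continuity at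
    every real point, including 0. *)
Lemma continuous_comp_normr {R : realType} (f : R -> R) :
  {within `[0, +oo[, continuous f} -> continuous (fun x : R => f `|x|).
Proof.
move=> /subspace_continuousP cf x U.
have nn (y : R) : [set` `[0, +oo[] `|y| by rewrite /= in_itv/= normr_ge0.
move=> /(cf _ (nn x)) cU; have := @norm_continuous _ R x _ cU.
move=> cUx; apply: (@filterS _ (nbhs x) _ _ _ _ cUx).
by move=> y /= /(_ (nn y)).
Qed.

Lemma continuous_powR_normr {R : realType} (p : R) : 0 < p ->
  continuous (fun x : R => `|x| `^ p).
Proof.
move=> p0 x; have [->|x0] := eqVneq x 0; last first.
  apply: (@continuous_comp _ _ _ (fun y : R => `|y|) (@powR R ^~ p)).
    exact: norm_continuous.
  apply: differentiable_continuous; apply/derivable1_diffP.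
  by apply: derivable_powR; rewrite in_itv/= normr_gt0 x0.
apply/cvgrPdist_lt => /= e e0; rewrite normr0 powR0 ?gt_eqF//.
near=> y; rewrite sub0r normrN ger0_norm ?powR_ge0//.
(* At the point 0: with [e] written as the p-th power of [e]^ p^-1[, the condition becomes]|y| < e
   [^ p^-1]. *)
rewrite -[ltRHS]powRr1 ?ltW// -(mulVf (lt0r_neq0 p0)) powRrM.
rewrite gt0_ltr_powR ?nnegrE ?powR_ge0//.
near: y; apply/nbhs_normP; exists (e `^ p^-1) => /=; first exact: powR_gt0.
by move=> y /=; rewrite sub0r normrN.
Unshelve. all: by end_near. Qed.

Lemma continuous_powR_comp {R : realType} (f : R -> R) (p x : R) : 0 < p ->
  (\forall y \near x, 0 <= f y) -> {for x, continuous f} ->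
  {for x, continuous (fun y => f y `^ p)}.
Proof.
move=> p0 f0 cf.
have c : {for x, continuous (fun y => `|f y| `^ p)}.
  apply: (@continuous_comp _ _ _ f (fun y => `|y| `^ p)) => //.
  exact: continuous_powR_normr.
rewrite /prop_for /continuous_at -[f x in X in _ --> X]ger0_norm; last first.
  exact: nbhs_singleton f0.
apply: cvg_trans c; apply: near_eq_cvg.
by near do rewrite ger0_norm//.
Unshelve. all: by end_near. Qed.

(** * Hoelder estimate of the weakly singular integral *)

(** Hoelder's inequality with exponent [q] on the kernel and [p] on [G]. The condition [beta^-1 < p]
    is what makes the q-th power of the kernel integrable up to [s = t]. *)
Lemma Rintegral_kernel_le {R : realType} (F G : R -> R) (t beta p q : R) :
  0 < t -> beta < 1 -> 0 < beta -> beta^-1 < p -> q = p / (p - 1) ->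
  measurable_fun (`]0, t[ : set R) F -> measurable_fun (`]0, t[ : set R) G ->
  (forall s, 0 < s < t -> `|F s| <= G s) ->
  lebesgue_measure.-integrable `]0, t[ (fun s => (G s `^ p)%:E) ->
  \int[lebesgue_measure]_(s in `]0, t[) ((t - s) `^ (beta - 1) * F s) <=
  t `^ (beta - 1 + q^-1) / (q * (beta - 1) + 1) `^ q^-1 *
  (\int[lebesgue_measure]_(s in `]0, t[) (G s `^ p)) `^ p^-1.
Proof.
move=> t0 b1 b0 bp qE mF mG FG iG.
have pb : 1 < p * beta by rewrite -ltr_pdivrMr// div1r.
have p1 : 1 < p by rewrite (lt_trans pb)// gtr_pMr// (lt_trans _ bp)// invr_gt0.
have p0 : 0 < p by exact: lt_trans p1.
have q0 : 0 < q by rewrite qE divr_gt0// subr_gt0.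
have pq : q^-1 + p^-1 = 1.
  by rewrite qE invf_div -{2}(div1r p) -mulrDl subrK divff// gt_eqF.
(* This number equals [(p * beta - 1) / (p - 1)]. *)
have e0 : 0 < q * (beta - 1) + 1.
  rewrite qE mulrAC -[X in _ + X](@divff _ (p - 1)) ?subr_eq0 ?gt_eqF//.
  by rewrite -mulrDl divr_gt0 ?subr_gt0//; lra.
pose k (s : R) := (t - s) `^ (beta - 1).
have mk : measurable_fun (`]0, t[ : set R) k.
  apply: measurable_funTS; apply: (measurableT_comp (measurable_powR _)).
  exact: measurable_funB.
have G0 s : 0 < s < t -> 0 <= G s.
  by move=> st; rewrite (le_trans _ (FG s st)).
pose JG := \int[lebesgue_measure]_(s in `]0, t[) (G s `^ p).
have JGE : (\int[lebesgue_measure]_(s in `]0%R, t[) (G s `^ p)%:E)%E = JG%:E.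
  by rewrite /JG /Rintegral fineK//; exact: integrable_fin_num.
pose B :=
  (t `^ (q * (beta - 1) + 1) / (q * (beta - 1) + 1)) `^ q^-1 * JG `^ p^-1.
have kGB : (\int[lebesgue_measure]_(s in `]0%R, t[) (k s * G s)%:E <= B%:E)%E.
  have k0 s : `]0, t[%classic s -> 0 <= k s by move=> _; exact: powR_ge0.
  have G0' s : `]0, t[%classic s -> 0 <= G s by rewrite /= in_itv/=; exact: G0.
  have mD : measurable (`]0, t[ : set R) by exact: measurable_itv.
  apply: le_trans (@ge0_hoelder _ _ k G q p mD mk mG k0 G0' q0 p0 pq) _.
  rewrite JGE /B EFinM poweR_EFin lee_wpmul2r ?lee_fin ?powR_ge0//.
  rewrite -poweR_EFin gt0_ler_poweR//.
  - by rewrite invr_ge0 ltW.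
  - rewrite in_itv/= leey andbT; apply: integral_ge0 => s _.
    by rewrite lee_fin powR_ge0.
  - by rewrite in_itv/= leey andbT lee_fin divr_ge0 ?powR_ge0// ltW.
  under eq_integral do rewrite /k -powRrM (mulrC (beta - 1)).
  exact: integral_powR_onem_le.
have BE : B =
    t `^ (beta - 1 + q^-1) / (q * (beta - 1) + 1) `^ q^-1 * JG `^ p^-1.
  rewrite /B; congr (_ * _); rewrite powRM ?powR_ge0 ?invr_ge0 ?(ltW e0)//.
  rewrite -powRrM -(powR_inv1 (ltW e0)) -[in LHS](powRrM _ (-1)) mulN1r powRN.
  by congr (_ `^ _ * _); field; rewrite gt_eqF.
rewrite -/JG -BE.
(* Comparing the real-valued integrals requires integrability: that of [k * G] comes from the bound
   [B] just obtained, that of [k * F] from domination by [k * G]. *)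
have ikG : lebesgue_measure.-integrable `]0, t[ (EFin \o (fun s => k s * G s)).
  apply/integrableP; split; first exact/measurable_EFinP/measurable_funM.
  apply: le_lt_trans (ltry B); apply: le_trans kGB.
  rewrite le_eqVlt; apply/orP; left; apply/eqP; apply: eq_integral => s.
  rewrite inE/= in_itv/= => st.
  by rewrite ger0_norm// mulr_ge0 ?powR_ge0 ?G0.
have ikF : lebesgue_measure.-integrable `]0, t[ (EFin \o (fun s => k s * F s)).
  apply: le_integrable ikG => //.
    exact/measurable_EFinP/measurable_funM.
  move=> s; rewrite /= in_itv/= => st; rewrite lee_fin !normrM.
  by rewrite ler_wpM2l// (le_trans (FG s st))// ler_norm.
apply: (@le_trans _ _ (\int[lebesgue_measure]_(s in `]0, t[) (k s * G s))).
  apply: le_Rintegral => // s; rewrite /= in_itv/= => st.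
  by rewrite ler_wpM2l ?powR_ge0// (le_trans (ler_norm _))// FG.
rewrite -lee_fin /Rintegral fineK//; exact: integrable_fin_num.
Qed.

(** * Bihari's inequality in integral form *)

(** Let [Z t = A + I h t] and let [Phi] be a primitive of [1/m]. Then [Phi (Z t) - I g t] has
    derivative [h t / m (Z t) - g t <= 0]. This is used only between times at which [Z] takes values
    [c < d] strictly inside []A, Z t0[], where [m > 0]; exhausting that interval presupposes no
    integrability of [1/m] at [A]. *)
Lemma bihari_integral_le {R : realType} (m g h : R -> R) (A t0 : R) :
  0 <= A -> 0 < t0 ->
  (forall x, 0 <= x -> 0 <= m x) ->
  {in `[0, +oo[ &, {homo m : x y / x <= y}} ->
  (forall x, 0 < x -> {for x, continuous m}) ->
  lebesgue_measure.-integrable `[0, t0] (EFin \o g) ->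
  lebesgue_measure.-integrable `[0, t0] (EFin \o h) ->
  {in `]0, t0[, continuous g} -> {in `]0, t0[, continuous h} ->
  (forall t, 0 < t <= t0 -> 0 <= g t) ->
  (forall t, 0 < t <= t0 -> 0 <= h t) ->
  (forall t, 0 < t <= t0 ->
    h t <= g t * m (A + \int[lebesgue_measure]_(s in `[0, t]) h s)) ->
  (\int[lebesgue_measure]_(x in
      `]A, (A + \int[lebesgue_measure]_(s in `[0%R, t0]) h s)%R[) ((m x)%:E)^-1 <=
   (\int[lebesgue_measure]_(s in `[0%R, t0]) g s)%:E)%E.
Proof.
move=> A0 t00 m0 mm mc ig ih cg ch g0 h0 hg.
pose I (f : R -> R) t := \int[lebesgue_measure]_(s in `[0, t]) f s.
pose Z t := A + I h t.
rewrite -/(I h t0) -/(Z t0) -/(I g t0).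
have I0 f : I f 0 = 0 by rewrite /I set_itv1 Rintegral_set1.
have I_le (f : R -> R) : lebesgue_measure.-integrable `[0, t0] (EFin \o f) ->
    (forall t, 0 < t <= t0 -> 0 <= f t) ->
    forall s t, 0 <= s -> s <= t -> t <= t0 -> I f s <= I f t.
  move=> intf f0 s t s0 st tt; rewrite -subr_ge0 /I Rintegral_itvB//.
  - apply: Rintegral_ge0 => x /=; rewrite in_itv/= => /andP[sx xt].
    by apply: f0; rewrite (le_lt_trans s0)//= (le_trans xt).
  - apply: integrableS intf => //.
    by apply: subset_itvl; rewrite bnd_simp.
have Z_le s t : 0 <= s -> s <= t -> t <= t0 -> Z s <= Z t.
  by move=> s0 st tt; rewrite lerD2l; exact: I_le.
have dI f t : lebesgue_measure.-integrable `[0, t0] (EFin \o f) ->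
    {in `]0, t0[, continuous f} -> 0 < t -> t < t0 -> is_derive t 1 (I f) (f t).
  move=> intf cf tgt tlt.
  have [|df <-] := continuous_FTC1_closed tlt intf tgt.
    by apply: cf; rewrite in_itv/= tgt.
  by rewrite derive1E; exact: derivableP.
have [Zt0|AZ] := leP (Z t0) A.
  rewrite set_itv_ge ?integral_set0; last by rewrite bnd_simp -leNgt.
  by rewrite lee_fin -(I0 g); apply: I_le => //; exact: ltW.
(* [Z] is continuous on [[0, t0]] with [Z 0 = A], so every level up to [Z t0] is attained. *)
have ivt y : A <= y <= Z t0 -> exists2 s, 0 <= s <= t0 & Z s = y.
  move=> /andP[Ay yZ].
  have [||s] := @IVT R (I h) 0 t0 (y - A) (ltW t00).
  - exact: parameterized_integral_continuous (ltW t00) ih.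
  - rewrite I0 ge_min le_max subr_ge0 Ay/=; apply/orP; right.
    by rewrite lerBlDl.
  - by rewrite in_itv/= => s0 Is; exists s => //; rewrite /Z Is addrC subrK.
(* If m vanished at Z s, it would vanish on Z ([0, s]), so that h = 0 there
   and Z s = A. *)
have m_gt0 y : A < y <= Z t0 -> 0 < m y.
  move=> /andP[Ay yZ]; rewrite lt_neqAle m0 ?(le_trans A0) ?(ltW Ay)// andbT.
  apply/eqP => my; have [|s /andP[s0 st] Zs] := ivt y; first by rewrite ltW.
  suff : Z s = A by move=> E; move: Ay; rewrite -Zs E ltxx.
  rewrite /Z /I -Rintegral_itv_obnd_cbnd; last first.
    by apply: integrableS ih => //; apply: subset_itv; rewrite bnd_simp.
  rewrite -[RHS]addr0; congr (_ + _).
  rewrite /Rintegral integral0_eq// => r /=; rewrite in_itv/= => /andP[r0 rs].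
  congr EFin; apply/eqP; rewrite eq_le h0 ?r0/= ?(le_trans rs)// andbT.
  rewrite (le_trans (hg _ _)) ?r0/= ?(le_trans rs)//.
  rewrite mulr_ge0_le0 ?g0 ?r0/= ?(le_trans rs)//.
  have AZr : A <= Z r.
    by rewrite -[leLHS]addr0 -(I0 h) Z_le// ?(ltW r0)// (le_trans rs).
  rewrite [leRHS]my; apply: mm.
  - by rewrite in_itv/= andbT; exact: le_trans A0 AZr.
  - by rewrite in_itv/= andbT; exact: le_trans A0 (ltW Ay).
  - by rewrite -Zs Z_le// ltW.
apply: ge0_integral_oo_le.
- apply: measurable_mono_inve => // x /=; rewrite !in_itv/= => /andP[Ax _].
  by rewrite andbT (le_trans A0)// ltW.
- move=> x; rewrite in_itv/= => /andP[Ax _].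
  by rewrite inve_ge0 lee_fin m0// (le_trans A0)// ltW.
- by rewrite lee_fin -(I0 g); apply: I_le => //; exact: ltW.
move=> c d Ac cd dZ.
(* The primitive of 1/m is based at c' < c so that it is derivable on [c, d],
   including at c, where Z may stay for some time. *)
pose c' := (A + c) / 2.
have Ac' : A < c' by rewrite /c'; lra.
have c'c : c' < c by rewrite /c'; lra.
pose r x := (m x)^-1.
have rc x : c' <= x <= Z t0 -> {for x, continuous r}.
  move=> /andP[c'x xZ]; apply: cvgV.
    by rewrite gt_eqF// m_gt0// xZ (lt_le_trans Ac').
  by apply: mc; rewrite (le_lt_trans A0)// (lt_le_trans Ac').
have ir : lebesgue_measure.-integrable `[c', Z t0] (EFin \o r).
  apply: continuous_compact_integrable; first exact: segment_compact.
  apply: continuous_in_subspaceT => x /[1!inE]/=.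
  by rewrite in_itv/=; exact: rc.
pose Phi x := \int[lebesgue_measure]_(s in `[c', x]) r s.
have dPhi x : c' < x -> x < Z t0 -> is_derive x 1 Phi (r x).
  move=> c'x xZ; have [|df <-] := continuous_FTC1_closed xZ ir c'x.
    by apply: rc; rewrite !ltW.
  by rewrite derive1E; exact: derivableP.
have [|s /andP[s0 st] Zs] := ivt c.
  by rewrite (ltW Ac) ltW// (lt_trans cd).
have [|e /andP[e0 et] Ze] := ivt d.
  by rewrite (ltW dZ) ltW// (lt_trans Ac).
have se : s < e.
  rewrite ltNge; apply/negP => es.
  by have := Z_le _ _ e0 es st; rewrite Zs Ze leNgt cd.
(* The strict inequalities [A < c] and [d < Z t0] keep [s] and [e] away from 0 and [t0], so that
   [I h] and [I g] are derivable on all of [[s, e]]. *)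
have {}s0 : 0 < s.
  rewrite lt_neqAle s0 andbT; apply/eqP => E.
  by move: Ac; rewrite -Zs -E /Z I0 addr0 ltxx.
have {}et : e < t0.
  by rewrite lt_neqAle et andbT; apply/eqP => E; move: dZ; rewrite -Ze E ltxx.
pose G t := Phi (Z t) - I g t.
have dG t : s <= t <= e -> is_derive t 1 G (r (Z t) * h t - g t).
  move=> /andP[st' te].
  have t0' : 0 < t by exact: lt_le_trans st'.
  have tt0 : t < t0 by exact: le_lt_trans et.
  have dh := dI _ _ ih ch t0' tt0; have dg := dI _ _ ig cg t0' tt0.
  have dZ' : is_derive t 1 Z (h t).
    have := is_deriveD (is_derive_cst A t 1) dh; by rewrite add0r.
  have dP : is_derive (Z t) 1 Phi (r (Z t)).
    apply: dPhi.
    - by rewrite (lt_le_trans c'c)// -Zs Z_le// ltW.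
    - by rewrite (le_lt_trans _ dZ)// -Ze Z_le// ltW.
  exact: (is_deriveB (@is_derive1_comp _ Phi Z t _ _ dP dZ') dg).
have dG_le0 t : s <= t <= e -> r (Z t) * h t - g t <= 0.
  move=> /andP[st' te].
  have t0' : 0 < t by exact: lt_le_trans st'.
  have tt0 : t <= t0 by rewrite ltW// (le_lt_trans te).
  have cZ : c <= Z t by rewrite -Zs Z_le// ltW.
  have ZtZ : Z t <= Z t0 by rewrite Z_le// ltW.
  have mZ : 0 < m (Z t) by rewrite m_gt0// ZtZ (lt_le_trans Ac).
  by rewrite subr_le0 /r mulrC ler_pdivrMr// hg// t0'.
have Ges : G e <= G s.
  have se' := ltW se.
  apply: (@ler0_derive1_le_cc R G s e _ _ _ e s _ _ se').
  - move=> x /subset_itv_oo_cc; rewrite in_itv/= => xse.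
    by have d1 := dG _ xse; exact: ex_derive.
  - move=> x /subset_itv_oo_cc; rewrite in_itv/= => xse.
    by have d1 := dG _ xse; rewrite derive1E derive_val dG_le0.
  - apply: derivable_within_continuous => x; rewrite in_itv/= => xse.
    by have d1 := dG _ xse; exact: ex_derive.
  - by rewrite in_itv/= lexx se'.
  - by rewrite in_itv/= lexx se'.
have ircd : lebesgue_measure.-integrable `[c, d] (EFin \o r).
  by apply: integrableS ir => //; apply: subset_itv; rewrite bnd_simp ltW.
(* Since [m > 0] on [[c, d]], the extended inverse is the real inverse [r] there. *)
have -> : (\int[lebesgue_measure]_(x in `[c, d]) ((m x)%:E)^-1 =
    (Phi d - Phi c)%:E)%E.
  rewrite /Phi Rintegral_itvB//; last 3 first.
  - by apply: integrableS ir => //; apply: subset_itvl; rewrite bnd_simp ltW.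
  - by rewrite bnd_simp ltW.
  - by rewrite bnd_simp ltW.
  rewrite Rintegral_itv_obnd_cbnd; last first.
    by apply: integrableS ircd => //; exact: subset_itv_oc_cc.
  rewrite /Rintegral fineK; last exact: integrable_fin_num.
  apply: eq_integral => x /[1!inE]/=; rewrite in_itv/= => /andP[cx xd].
  rewrite inver gt_eqF// m_gt0// (lt_le_trans Ac)//=.
  by rewrite (le_trans xd)// ltW.
(* [G e <= G s] reads [Phi d - Phi c <= I g e - I g s], and [I g s >= 0], [I g e <= I g t0]. *)
rewrite lee_fin; move: Ges; rewrite /G Zs Ze.
have := I_le _ ig g0 0 s (lexx _) (ltW s0) (ltW (lt_trans se et)).
have := I_le _ ig g0 e t0 e0 (ltW et) (lexx _).
rewrite I0; lra.
Qed.

(** * Monotonicity of [Omega] and comparison with its inverse *)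

Lemma ge0_integral_itv_split {R : realType} (F : R -> \bar R) (a b c : R) :
  a <= b -> b <= c -> measurable_fun (`[a, c] : set R) F ->
  (forall x, (0 <= F x)%E) ->
  (\int[lebesgue_measure]_(x in `[a, c]) F x =
   \int[lebesgue_measure]_(x in `[a, b]) F x +
   \int[lebesgue_measure]_(x in `[b, c]) F x)%E.
Proof.
move=> ab bc mF F0.
rewrite (@itv_bndbnd_setU _ _ _ (BRight b)) ?bnd_simp//.
rewrite ge0_integral_setU//.
- rewrite integral_itv_obnd_cbnd//; apply: measurable_funS mF => //.
  by apply: subset_itvr; rewrite bnd_simp.
- by rewrite -itv_bndbnd_setU ?bnd_simp.
- apply/disj_setPS => x /= []; rewrite !in_itv/= => /andP[_ xb] /andP[bx _].
  by move: bx; rewrite ltNge xb.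
Qed.

Section Omega_order.
Context {R : realType} (omega : R -> R) (p : R).
Hypothesis p0 : 0 < p.
Hypothesis omega_ge0 : forall x, 0 <= x -> 0 <= omega x.
Hypothesis omega_mono : {in `[0, +oo[ &, {homo omega : x y / x <= y}}.

Lemma mu_fun_mono : {in `[0, +oo[ &, {homo mu_fun omega p : x y / x <= y}}.
Proof.
move=> x y; rewrite !in_itv/= !andbT => x0 y0 xy.
have nn z : 0 <= 2 `^ (1 - p^-1) * z `^ p^-1 by rewrite mulr_ge0 ?powR_ge0.
rewrite /mu_fun ge0_ler_powR ?nnegrE ?omega_ge0 ?(ltW p0)//.
apply: omega_mono; rewrite ?in_itv/= ?andbT//.
rewrite ler_wpM2l ?powR_ge0// ge0_ler_powR ?nnegrE// invr_ge0 ltW//.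
Qed.

Let F x := (((mu_fun omega p x)%:E)^-1)%E.

Let F0 x : (0 <= F x)%E.
Proof. by rewrite inve_ge0 lee_fin powR_ge0. Qed.

Let nn (a b : R) : (0 <= \int[lebesgue_measure]_(x in `[a, b]) F x)%E.
Proof. by apply: integral_ge0 => x _; exact: F0. Qed.

Let mF (D : set R) : measurable D -> D `<=` `[0, +oo[ -> measurable_fun D F.
Proof.
move=> mD D0; apply: measurable_mono_inve => //.
- by move=> x _; exact: powR_ge0.
- exact: mu_fun_mono.
Qed.

Let mFcc a b : 0 <= a -> measurable_fun (`[a, b] : set R) F.
Proof.
move=> a0; apply: mF => // x /=; rewrite !in_itv/= => /andP[ax _].
by rewrite andbT (le_trans a0).
Qed.

(** Additivity of the integral of [1/mu] when [A] and [B] lie on the same side of 1; otherwise 0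
    separates the two values. *)
Lemma Omega_le A B : 0 <= A -> A <= B -> (Omega omega p A <= Omega omega p B)%E.
Proof.
move=> A0 AB; rewrite /Omega -/F.
have [A1|A1] := leP 1 A.
  rewrite (le_trans A1 AB).
  rewrite (@ge0_integral_itv_split _ F _ _ _ A1 AB (mFcc 1 B ler01) F0).
  by rewrite leeDl// nn.
have [B1|B1] := leP 1 B.
  by apply: (@le_trans _ _ 0%E); rewrite ?oppe_le0; exact: nn.
rewrite leeN2 (@ge0_integral_itv_split _ F _ _ _ AB (ltW B1) (mFcc A 1 A0) F0).
by rewrite leeDr// nn.
Qed.

(** The increment of [Omega] is the integral over []A, B[]. The bound is additive rather than on a
    difference because both values may be [-oo]. *)
Lemma Omega_le_add A B K : 0 <= A -> A <= B -> 0 <= K ->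
  (\int[lebesgue_measure]_(x in `]A, B[) F x <= K%:E)%E ->
  (Omega omega p B <= Omega omega p A + K%:E)%E.
Proof.
move=> A0 AB K0; rewrite -(@integral_itv_bndoo _ _ _ _ true false); last first.
  apply: mF => // x /=; rewrite !in_itv/= => /andP[Ax _].
  by rewrite andbT (le_trans A0)// ltW.
move=> FK; rewrite /Omega -/F.
have [A1|A1] := leP 1 A.
  rewrite (le_trans A1 AB).
  rewrite (@ge0_integral_itv_split _ F _ _ _ A1 AB (mFcc 1 B ler01) F0).
  by rewrite leeD2l.
(* Any part of the integral over [[A, B]] is finite, being at most [K], so it may be moved across
   the inequality. When [B < 1] the integral over [[B, 1]] may be infinite; it occurs on both sides
   and is dropped by monotonicity of addition. *)
have fin (x : \bar R) : (0 <= x)%E -> (x <= K%:E)%E -> x \is a fin_num.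
  by move=> x0 xK; rewrite ge0_fin_numE// (le_lt_trans xK) ?ltry.
have [B1|B1] := leP 1 B.
  move: FK.
  rewrite (@ge0_integral_itv_split _ F _ _ _ (ltW A1) B1 (mFcc A B A0) F0).
  move=> FK; rewrite addeC leeBrDr; first by rewrite addeC.
  by apply: fin => //; rewrite (le_trans _ FK)// leeDl.
rewrite (@ge0_integral_itv_split _ F _ _ _ AB (ltW B1) (mFcc A 1 A0) F0).
have fAB := fin _ (nn A B) FK.
rewrite oppeD ?fin_num_adde_defr// addeAC -[leLHS]add0e leeD2r//.
by rewrite addeC sube_ge0 ?fAB ?orbT.
Qed.

End Omega_order.

(** If [z] exceeded the preimage [x] of [y], monotonicity would give [Omega z >= y], hence equality,
    and uniqueness of the preimage would force [z = x]. Uniqueness thus plays the part of strict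
    monotonicity. *)
Lemma le_Omega_inv {R : realType} (omega : R -> R) (p z : R) (y : \bar R) :
  0 < p -> (forall x, 0 <= x -> 0 <= omega x) ->
  {in `[0, +oo[ &, {homo omega : x y / x <= y}} ->
  Omega_inv_dom omega p y -> 0 <= z -> (Omega omega p z <= y)%E ->
  z <= Omega_inv omega p y.
Proof.
move=> p0 omega0 omono [x [[x0 Ox] xuniq]] z0 zy.
have xdom : Omega_inv_dom omega p (Omega omega p x) by exists x; rewrite Ox.
have E : Omega_inv omega p y = x by rewrite -Ox; exact: Omega_invP.
rewrite E leNgt; apply/negP => xz.
have Oz : Omega omega p z = y.
  apply/eqP; rewrite eq_le zy -Ox.
  by rewrite (@Omega_le _ _ _ p0 omega0 omono _ _ x0 (ltW xz)).
by move: xz; rewrite (xuniq z)// ltxx.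
Qed.

(** * The function [mu], the rescaling by [2 ^ (p - 1)], and the pointwise bound *)

Lemma continuous_mu_fun {R : realType} (omega : R -> R) (p x : R) :
  0 < p -> (forall x, 0 <= x -> 0 <= omega x) ->
  {within `[0, +oo[, continuous omega} ->
  0 < x -> {for x, continuous (mu_fun omega p)}.
Proof.
move=> p0 omega0 comega x0.
have nn y : 0 <= 2 `^ (1 - p^-1) * y `^ p^-1 :> R by rewrite mulr_ge0 ?powR_ge0.
apply: (@continuous_powR_comp _
  (fun y => omega (2 `^ (1 - p^-1) * y `^ p^-1))) => //.
  by near=> y; exact: omega0.
have -> : (fun y => omega (2 `^ (1 - p^-1) * y `^ p^-1)) =
    (fun y => omega `|y|) \o (fun y => 2 `^ (1 - p^-1) * y `^ p^-1).
  by apply/funext => y /=; rewrite ger0_norm.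
apply: continuous_comp; last exact: continuous_comp_normr.
apply: continuousM; first exact: cst_continuous.
apply: differentiable_continuous; apply/derivable1_diffP.
by apply: derivable_powR; rewrite in_itv/= x0.
Unshelve. all: by end_near. Qed.

(** The powers of 2 cancel because [1 - 1/p = (p - 1)/p]. This explains the constant in [mu]: it
    undoes the factor [2 ^ (p - 1)] coming from convexity. *)
Lemma powR_rescale {R : realType} (p w : R) : 0 < p -> 0 <= w ->
  2 `^ (1 - p^-1) * (w `^ p / 2 `^ (p - 1)) `^ p^-1 = w.
Proof.
move=> p0 w0; rewrite powRM ?powR_ge0 ?invr_ge0 ?powR_ge0//.
rewrite -powRrM divff ?gt_eqF// powRr1// -powRN -powRrM.
rewrite mulrCA -powRD; last by rewrite pnatr_eq0 implybT.
have -> : 1 - p^-1 + - (p - 1) * p^-1 = 0 by field; rewrite gt_eqF.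
by rewrite powRr0 mulr1.
Qed.

Lemma mu_fun_rescale {R : realType} (omega : R -> R) (p w : R) :
  0 < p -> 0 <= w -> mu_fun omega p (w `^ p / 2 `^ (p - 1)) = omega w `^ p.
Proof. by move=> p0 w0; rewrite /mu_fun powR_rescale. Qed.

Lemma c_fun_ge0 {R : realType} (b alpha beta delta q r : R) :
  0 <= b -> 0 <= c_fun b alpha beta delta q r.
Proof. by move=> b0; rewrite /c_fun divr_ge0 ?mulr_ge0 ?powR_ge0. Qed.

(** Allows [c(r)] to be replaced by the constant [c(t)] for all [r <= t]. *)
Lemma c_fun_le {R : realType} (b alpha beta delta q r t : R) :
  0 <= b -> 0 <= alpha - delta + beta - 1 + q^-1 -> 0 <= r -> r <= t ->
  c_fun b alpha beta delta q r <= c_fun b alpha beta delta q t.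
Proof.
move=> b0 e0 r0 rt; rewrite /c_fun ler_wpM2r ?invr_ge0 ?powR_ge0//.
by rewrite ler_wpM2l// ge0_ler_powR ?nnegrE// (le_trans r0).
Qed.

(** Here [x] stands for [u(r)], [J] for the singular integral and [S] for the integral of the p-th
    power of its majorant. Multiplying by [r ^ alpha] gives [w <= a + c(r) S^(1/p)], the exponents
    of [r] adding up to that of [c_fun]; then [powRD_le] applies. *)
Lemma powR_volterra_le {R : realType} (a b alpha beta delta p q r x J S : R) :
  1 <= p -> 0 <= a -> 0 <= b -> 0 < r -> 0 <= r `^ alpha * x -> 0 <= S ->
  x <= a * r `^ (- alpha) + b * r `^ (- delta) * J ->
  J <= r `^ (beta - 1 + q^-1) / (q * (beta - 1) + 1) `^ q^-1 * S `^ p^-1 ->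
  (r `^ alpha * x) `^ p <=
    2 `^ (p - 1) * (a `^ p + c_fun b alpha beta delta q r `^ p * S).
Proof.
move=> p1 a0 b0 r0 w0 S0 xJ JS.
have p0 : 0 < p by exact: lt_le_trans p1.
have c0 := @c_fun_ge0 R b alpha beta delta q r b0.
have rn : r != 0 by rewrite gt_eqF.
have wle : r `^ alpha * x <= a + c_fun b alpha beta delta q r * S `^ p^-1.
  apply: (@le_trans _ _ (r `^ alpha *
      (a * r `^ (- alpha) + b * r `^ (- delta) * J))).
    by rewrite ler_wpM2l// powR_ge0.
  rewrite mulrDr mulrCA -powRD ?rn ?implybT// subrr powRr0 mulr1 lerD2l.
  apply: (@le_trans _ _ (r `^ alpha * (b * r `^ (- delta) *
    (r `^ (beta - 1 + q^-1) / (q * (beta - 1) + 1) `^ q^-1 * S `^ p^-1)))).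
    by rewrite ler_wpM2l ?powR_ge0// ler_wpM2l// mulr_ge0// powR_ge0.
  rewrite /c_fun.
  have -> : alpha - delta + beta - 1 + q^-1 =
    alpha + (- delta + (beta - 1 + q^-1)) by ring.
  rewrite !powRD ?rn ?implybT// le_eqVlt; apply/orP; left; apply/eqP.
  set A := _ `^ q^-1; move: (A^-1) => A'; ring.
apply: (@le_trans _ _ ((a + c_fun b alpha beta delta q r * S `^ p^-1) `^ p)).
  by rewrite ge0_ler_powR ?nnegrE ?(ltW p0)// addr_ge0// mulr_ge0// powR_ge0.
apply: le_trans (@powRD_le _ _ _ _ p1 a0 _) _.
  by rewrite mulr_ge0// powR_ge0.
by rewrite powRM ?powR_ge0// -powRrM mulVf ?gt_eqF// powRr1.
Qed.

(** * Reduction of the theorem to Bihari's inequality *)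

Theorem theorem2p4 (R : realType) (T : \bar R)
    (a b alpha beta delta p q : R)
    (f : R -> R -> R) (l omega u : R -> R) (T1 : R)
    (T_gt0 : (0 < T)%E)
    (a_ge0 : 0 <= a) (b_ge0 : 0 <= b)
    (delta_ge0 : 0 <= delta) (delta_lt_alpha : delta < alpha)
    (beta_gt0 : 0 < beta) (beta_lt1 : beta < 1)
    (p_gt : beta^-1 < p) (q_def : q = p / (p - 1))
    (f_cont : {within oo_itv T `*` [set: R],
                 continuous (fun tx : R * R => f tx.1 tx.2)})
    (f_bound : forall t x : R, oo_itv T t ->
                 `|f t x| <= l t * omega (t `^ alpha * `|x|))
    (l_cont : {within oo_itv T, continuous l})
    (l_Lp : Lp_loc p T l)
    (l_ge0 : forall t, oo_itv T t -> 0 <= l t)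
    (omega_cont : {within `[0, +oo[, continuous omega})
    (omega_mono : {in `[0, +oo[ &, {homo omega : x y / x <= y}})
    (omega_ge0 : forall x, 0 <= x -> 0 <= omega x)
    (u_cont : continuous_nonneg_ext T (fun t => t `^ alpha * u t))
    (u_bound : forall t, oo_itv T t ->
       u t <= a * t `^ (- alpha) +
              b * t `^ (- delta) *
              \int[lebesgue_measure]_(s in `]0, t[)
                ((t - s) `^ (beta - 1) * f s (u s)))
    (T1_in : oo_itv T T1)
    (T1_dom : forall t, 0 <= t <= T1 ->
       Omega_inv_dom omega p (Omega_arg omega l a b alpha beta delta p q t)) :
  forall t, 0 < t <= T1 ->
    u t <= 2 `^ (1 - p^-1) * t `^ (- alpha) *
           Omega_inv omega p (Omega_arg omega l a b alpha beta delta p q t)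
             `^ p^-1.
Proof.
move=> t /andP[t0 tT1].
have tT : (t%:E < T)%E by apply: le_lt_trans T1_in.2; rewrite lee_fin.
have pb : 1 < p * beta by rewrite -ltr_pdivrMr// div1r.
have p1 : 1 < p.
  by rewrite (lt_trans pb)// gtr_pMr// (lt_trans _ p_gt)// invr_gt0.
have p0 : 0 < p by exact: lt_trans p1.
(* Since [1/q = 1 - 1/p], the exponent of [c] is [alpha - delta] plus [beta - 1/p], both
   positive. *)
have e0 : 0 <= alpha - delta + beta - 1 + q^-1.
  have -> : alpha - delta + beta - 1 + q^-1 =
      (alpha - delta) + (p * beta - 1) / p.
    by rewrite q_def; field; rewrite !gt_eqF// subr_gt0.
  by rewrite addr_ge0 ?divr_ge0 ?subr_ge0 ?ltW.
have tt : 0 < t <= t by rewrite t0 lexx.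
have [w [wc w0 wu]] := u_cont.
have itvT s : 0 < s <= t -> oo_itv T s.
  by move=> /andP[s0 st]; split=> //; apply: le_lt_trans tT; rewrite lee_fin.
have itvo s : s \in `]0, t[ -> 0 < s <= t.
  by rewrite in_itv/= => /andP[-> /ltW].
have wE s : 0 < s <= t -> s `^ alpha * u s = w s by move=> /itvT/wu.
have w_ge0 s : 0 < s <= t -> 0 <= w s.
  by move=> /itvT[s0 sT]; apply: w0; split=> //; exact: ltW.
have oc (k : R -> R) (A : set R) : `]0, t[ `<=` A -> {within A, continuous k} ->
    {in `]0, t[, continuous k}.
  move=> tA /(continuous_subspaceW tA); rewrite continuous_open_subspace//.
  by move=> ck s st; apply: ck; rewrite inE.
have itv_oo : `]0, t[ `<=` oo_itv T by move=> s /itvo/itvT.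
have cw : {in `]0, t[, continuous w}.
  apply: oc wc => s /itv_oo[s0 sT]; split=> //; exact: ltW.
have cl : {in `]0, t[, continuous l} by exact: oc l_cont.
pose ow s := omega (w s).
have ow0 s : 0 < s <= t -> 0 <= ow s by move=> /w_ge0; exact: omega_ge0.
have near_itv s (P : R -> Prop) : s \in `]0, t[ ->
    (forall r, 0 < r <= t -> P r) -> \forall r \near s, P r.
  move=> st HP; near=> r; apply: HP; apply: itvo; near: r.
  exact: near_in_itvoo.
have cow : {in `]0, t[, continuous ow}.
  move=> s st.
  have c : {for s, continuous (fun r => omega `|w r|)}.
    apply: (@continuous_comp _ _ _ w (fun x => omega `|x|)); first exact: cw.
    exact: continuous_comp_normr.
  rewrite /continuous_at /ow -[w s in X in _ --> X]ger0_norm; last first.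
    exact/w_ge0/itvo.
  apply: cvg_trans c; apply: near_eq_cvg; apply: near_itv => // r rt /=.
  by rewrite ger0_norm// w_ge0.
pose C := c_fun b alpha beta delta q t `^ p.
have C0 : 0 <= C by exact: powR_ge0.
have l0 s : 0 < s <= t -> 0 <= l s by move=> /itvT; exact: l_ge0.
pose G s := l s * ow s.
pose lp s := l s `^ p.
pose g s := C * lp s.
pose h s := C * G s `^ p.
have G0 s : 0 < s <= t -> 0 <= G s by move=> st; rewrite mulr_ge0 ?l0 ?ow0.
have clp : {in `]0, t[, continuous lp}.
  move=> s st; apply: continuous_powR_comp => //; last exact: cl.
  by apply: near_itv => // r; exact: l0.
have cG : {in `]0, t[, continuous G}.
  by move=> s st; apply: continuousM; [exact: cl|exact: cow].
have cGp : {in `]0, t[, continuous (fun s => G s `^ p)}.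
  move=> s st; apply: continuous_powR_comp => //; last exact: cG.
  by apply: near_itv => // r; exact: G0.
have meas (k : R -> R) : {in `]0, t[, continuous k} ->
    measurable_fun (`]0, t[ : set R) k.
  move=> ck; apply: open_continuous_measurable_fun => //.
  by move=> s; rewrite inE; exact: ck.
have ilp : lebesgue_measure.-integrable `]0, t[ (EFin \o lp).
  have il := Lfun_integrable (ltW p1) (l_Lp t (itvT t tt)).
  have {}il : lebesgue_measure.-integrable (`]0, t[ : set R)
      (fun x : R => (`|(l \_ `]0, t]) x| `^ p)%:E).
    by apply: integrableS il.
  move: il.
  apply: eq_integrable => // s; rewrite inE/= => st.
  rewrite patchE mem_set; last by rewrite /= in_itv/=; exact: itvo.
  by rewrite ger0_norm// l0// itvo.
(* The extension [w] is continuous on the compact [[0, t]], 0 included, so it has a maximum; [M] is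
   the value of [omega ^ p] there. It makes [G ^ p] integrable by comparison with [M * l ^ p]. *)
have [M M0 owM] : exists2 M, 0 <= M & forall s, 0 < s <= t -> ow s `^ p <= M.
  have wct : {within `[0, t], continuous w}.
    apply: continuous_subspaceW wc => s; rewrite /= in_itv/= => /andP[s0 st].
    by split=> //; apply: le_lt_trans tT; rewrite lee_fin.
  have [c _ cmax] := EVT_max (ltW t0) wct.
  exists (omega (w c) `^ p); first exact: powR_ge0.
  move=> s /[dup] st /andP[s0 s1].
  have wsc : w s <= w c by apply: cmax; rewrite in_itv/= ltW.
  have wc0 : 0 <= w c by rewrite (le_trans _ wsc)// w_ge0.
  have owc : ow s <= omega (w c).
    apply: omega_mono => //; rewrite in_itv/= andbT; [exact: w_ge0|exact: wc0].
  rewrite ge0_ler_powR ?nnegrE ?(ltW p0)//; [exact: ow0|exact: omega_ge0].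
have iGp : lebesgue_measure.-integrable `]0, t[ (fun s => (G s `^ p)%:E).
  have iM : lebesgue_measure.-integrable `]0, t[ (EFin \o (fun s => M * lp s)).
    exact: integrableZl ilp.
  apply: le_integrable iM => //; first by apply/measurable_EFinP; exact: meas.
  move=> s /itvo st; rewrite lee_fin.
  rewrite !ger0_norm ?mulr_ge0 ?powR_ge0// powRM ?l0 ?ow0// mulrC.
  by rewrite ler_wpM2r ?powR_ge0// owM.
have ig : lebesgue_measure.-integrable `[0, t] (EFin \o g).
  by apply: integrable_itv_oo_cc; exact: integrableZl ilp.
have ih : lebesgue_measure.-integrable `[0, t] (EFin \o h).
  by apply: integrable_itv_oo_cc; exact: integrableZl iGp.
pose Z r := a `^ p + \int[lebesgue_measure]_(s in `[0, r]) h s.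
pose z r := w r `^ p / 2 `^ (p - 1).
have sub_itv r : r <= t -> [set` `]0, r[] `<=` `]0, t[.
  by move=> rt; apply: subset_itvl; rewrite bnd_simp.
(* On []0, t[] the function [u] agrees with the continuous [v], and [f] is jointly continuous on the
   open strip over []0, t[], so the composition is continuous there. *)
have mf : measurable_fun (`]0, t[ : set R) (fun s => f s (u s)).
  pose v s := s `^ (- alpha) * w s.
  apply: (eq_measurable_fun (fun s => f s (v s))).
    move=> s /set_mem/itvo st.
    have sn0 : s != 0 by rewrite gt_eqF; case/andP: st.
    by rewrite /v -wE// mulrA -powRD ?sn0 ?implybT// addNr powRr0 mul1r.
  apply: meas => s st.
  have B : [set su : R * R | `]0, t[%classic su.1] `<=` oo_itv T `*` [set: R].
    by move=> su /= /itv_oo; split.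
  have oB : open [set su : R * R | `]0, t[%classic su.1].
    apply: (@open_comp _ _ fst `]0, t[%classic) => // x _; exact: cvg_fst.
  have := continuous_subspaceW B f_cont.
  rewrite continuous_open_subspace// => fB.
  apply: (@continuous_comp _ _ _ (fun s => (s, v s)) (fun su => f su.1 su.2)).
    have cv : {for s, continuous v}.
      apply: continuousM; last exact: cw.
      apply: differentiable_continuous; apply/derivable1_diffP.
      by apply: derivable_powR; rewrite in_itv/= andbT; case/andP: (itvo _ st).
    exact: (cvg_pair (@cvg_id _ _) cv).
  by apply: fB; rewrite inE.
have ch : {in `]0, t[, continuous h}.
  by move=> s st; apply: (@continuousM _ _ (cst C) (fun r => G r `^ p));
    [exact: cst_continuous|exact: cGp].
have zZ r : 0 < r <= t -> z r <= Z r.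
  move=> /[dup] rt /andP[r0 r1].
  have S0 : 0 <= \int[lebesgue_measure]_(s in `]0, r[) (G s `^ p).
    by apply: Rintegral_ge0 => s _; exact: powR_ge0.
  have iGr : lebesgue_measure.-integrable `]0, r[ (fun s => (G s `^ p)%:E).
    by apply: integrableS iGp => //; exact: sub_itv.
  have key : w r `^ p <= 2 `^ (p - 1) *
      (a `^ p + c_fun b alpha beta delta q r `^ p *
      \int[lebesgue_measure]_(s in `]0, r[) (G s `^ p)).
    rewrite -wE//; apply: powR_volterra_le (u_bound r (itvT r rt)) _ => //.
    - exact: ltW.
    - by rewrite wE// w_ge0.
    apply: Rintegral_kernel_le => //.
    - by apply: measurable_funS mf => //; exact: sub_itv.
    - by apply: measurable_funS (meas _ cG) => //; exact: sub_itv.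
    move=> s /andP[s0 sr].
    have st : 0 < s <= t by rewrite s0 ltW// (lt_le_trans sr).
    rewrite (le_trans (f_bound s (u s) (itvT s st)))// /G /ow -(wE s st).
    rewrite le_eqVlt; apply/orP; left; apply/eqP; congr (_ * omega _).
    (* The absolute value in the bound on [f] is harmless because [s ^ alpha * u s = w s >= 0]. *)
    rewrite -[RHS]ger0_norm ?wE ?w_ge0// -wE// normrM.
    by rewrite (ger0_norm (powR_ge0 _ _)).
  rewrite /z ler_pdivrMr ?powR_gt0// mulrC (le_trans key)//.
  rewrite ler_wpM2l ?powR_ge0// lerD2l.
  have -> : \int[lebesgue_measure]_(s in `[0, r]) h s =
      C * \int[lebesgue_measure]_(s in `]0, r[) (G s `^ p).
    rewrite Rintegral_itv_cc_oo ?RintegralZl//.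
    by apply: measurable_funS (meas _ ch) => //; exact: sub_itv.
  rewrite ler_wpM2r// ge0_ler_powR ?nnegrE ?(ltW p0) ?c_fun_ge0//.
  by rewrite c_fun_le// ltW.
have zmu r : 0 < r <= t -> mu_fun omega p (z r) = ow r `^ p.
  by move=> rt; rewrite /z mu_fun_rescale// w_ge0.
have z0 r : 0 <= z r by rewrite divr_ge0 ?powR_ge0.
have Z0 r : 0 <= Z r.
  rewrite addr_ge0 ?powR_ge0//; apply: Rintegral_ge0 => s _.
  by rewrite mulr_ge0 ?powR_ge0.
(* [omega(w) ^ p = mu(z)] by the rescaling, and [mu(z) <= mu(Z)] by monotonicity: this is the
   differential inequality for [Z]. *)
have hg r : 0 < r <= t -> h r <= g r * mu_fun omega p (Z r).
  move=> rt; rewrite /h /g /G powRM ?l0 ?ow0// -zmu// mulrA.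
  rewrite ler_wpM2l ?mulr_ge0 ?powR_ge0//.
  by apply: mu_fun_mono; rewrite ?in_itv/= ?andbT// zZ.
have mu0 x : 0 <= x -> 0 <= mu_fun omega p x by move=> _; exact: powR_ge0.
have cg : {in `]0, t[, continuous g}.
  by move=> s st; apply: (@continuousM _ _ (cst C) lp);
    [exact: cst_continuous|exact: clp].
have := @bihari_integral_le R (mu_fun omega p) g h (a `^ p) t (powR_ge0 _ _) t0
  mu0 (mu_fun_mono omega p p0 omega_ge0 omega_mono)
  (fun x => @continuous_mu_fun R omega p x p0 omega_ge0 omega_cont)
  ig ih cg ch.
move=> /(_ _ _ hg) bih.
have {}bih := bih (fun s _ => mulr_ge0 C0 (powR_ge0 _ _))
  (fun s _ => mulr_ge0 C0 (powR_ge0 _ _)).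
have gK : \int[lebesgue_measure]_(s in `[0, t]) g s =
    C * \int[lebesgue_measure]_(s in `]0, t[) lp s.
  by rewrite Rintegral_itv_cc_oo ?RintegralZl//; exact: meas.
rewrite gK -/(Z t) in bih.
have K0 : 0 <= C * \int[lebesgue_measure]_(s in `]0, t[) lp s.
  by rewrite mulr_ge0//; apply: Rintegral_ge0 => s _; exact: powR_ge0.
have aZ : a `^ p <= Z t.
  rewrite lerDl; apply: Rintegral_ge0 => s _; by rewrite mulr_ge0 ?powR_ge0.
(* The bound on the integral of [1/mu] from [a ^ p] to [Z t] becomes [Omega (Z t) <= Omega_arg] at
   time [t]. *)
have OZ := @Omega_le_add R omega p p0 omega_ge0 omega_mono _ _ _
  (powR_ge0 _ _) aZ K0 bih.
have dom : Omega_inv_dom omega p (Omega_arg omega l a b alpha beta delta p q t).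
  by apply: T1_dom; rewrite ltW.
have ZX := @le_Omega_inv R omega p (Z t) _ p0 omega_ge0 omega_mono dom
  (Z0 t) OZ.
have zX := le_trans (zZ t tt) ZX.
(* Undoing the rescaling produces the factor [2 ^ (1 - 1/p)] of the conclusion. *)
have wt : w t = 2 `^ (1 - p^-1) * z t `^ p^-1.
  by rewrite /z powR_rescale// w_ge0.
have -> : u t = t `^ (- alpha) * w t.
  rewrite -wE// mulrA -powRD; last by rewrite (gt_eqF t0) implybT.
  by rewrite addNr powRr0 mul1r.
rewrite wt mulrCA mulrA ler_wpM2l ?mulr_ge0 ?powR_ge0//.
by rewrite ge0_ler_powR ?nnegrE ?invr_ge0 ?(ltW p0)// (le_trans (Z0 t)).
Unshelve. all: by end_near. Qed.
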